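(* The assignment $D\mapsto\mathcal{M}_{\Gamma}(D)$ can be extended to a contravariant functor $\mathcal{M}_{\Gamma}\colon\mathbf{DLat}\to\mathbf{Pries}$ from the category of bounded distributive lattices and bound-preserving lattice homomorphisms to the category of Priestley spaces and continuous monotone maps, by setting, for every lattice homomorphism $h\colon D\to E$, $\mathcal{M}_{\Gamma}(h)\colon\mathcal{M}_{\Gamma}(E)\to\mathcal{M}_{\Gamma}(D)$, $\mu\mapsto\mu\circ h$.
   Context: The Priestley space $\mathbf{\Gamma}$. Its underlying set consists of formal symbols $\{r^{-}\mid r\in(0,1]\}\cup\{q^{\circ}\mid q\in[0,1]\cap\mathbb{Q}\}$, totally ordered by: $r^{-}<s^{-}$ iff $r<s$; $p^{\circ}<q^{\circ}$ iff $p<q$; $r^{-}<q^{\circ}$ iff $r\le q$; $q^{\circ}<r^{-}$ iff $q<r$. Its topology is generated by the sets $\{x\mid p^{\circ}\le x\}$ for $p\in\mathbb{Q}\cap[0,1]$ and $\{x\mid x\le q^{-}\}$ for $q\in\mathbb{Q}\cap(0,1]$. Two partial operations on $\mathbf{\Gamma}$, $x-y$ and $x\sim y$, are defined exactly when $y\le x$. The first is: $r^{\circ}-s^{\circ}=(r-s)^{\circ}$; $r^{-}-s^{\circ}=(r-s)^{-}$; and both $r^{\circ}-s^{-}$ and $r^{-}-s^{-}$ equal $(r-s)^{\circ}$ if $r-s\in\mathbb{Q}$ and $(r-s)^{-}$ otherwise. The second is $x\sim y=\bigvee\{x-q^{\circ}\mid q\in\mathbb{Q}\cap[0,1],\ y<q^{\circ}\le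 x\}$ (so $x\sim x=0^{\circ}$, the bottom element). A $\mathbf{\Gamma}$-valued measure on a bounded distributive lattice $D$ (with bounds $0,1$) is a function $\mu\colon D\to\mathbf{\Gamma}$ such that (1) $\mu$ is monotone; (2) $\mu(0)=0^{\circ}$ and $\mu(1)=1^{\circ}$; (3) for all $a,b\in D$, $\mu(a)\sim\mu(a\wedge b)\le\mu(a\vee b)-\mu(b)$ and $\mu(a)-\mu(a\wedge b)\ge\mu(a\vee b)\sim\mu(b)$. The set $\mathcal{M}_{\Gamma}(D)$ of all such measures carries the order and topology induced by the product order and product topology of $\mathbf{\Gamma}^{D}$; it is a Priestley space. *)

(* Defs.v *)
From HB Require Import structures.
From mathcomp Require Import all_boot all_order all_algebra.
From mathcomp Require Import all_classical all_reals all_analysis.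

Set Implicit Arguments.
Unset Strict Implicit.
Unset Printing Implicit Defensive.

Import Order.TTheory GRing.Theory Num.Theory.

Local Open Scope classical_set_scope.
Local Open Scope ring_scope.

Record category := Category {
  obj :> Type;
  hom : obj -> obj -> Type;
  idm : forall X, hom X X;
  compm : forall X Y Z, hom Y Z -> hom X Y -> hom X Z;
  compmA : forall W X Y Z (f : hom Y Z) (g : hom X Y) (h : hom W X),
    compm f (compm g h) = compm (compm f g) h;
  comp1m : forall X Y (f : hom X Y), compm (idm Y) f = f;
  compm1 : forall X Y (f : hom X Y), compm f (idm X) = f
}.
Arguments idm {c} X.
Arguments compm {c X Y Z}.

(* A contravariant functor from C to D whose action on objects is F0; to give
   such a record is to extend the assignment F0 to a functor. *)
Record contrafunctor (C D : category) (F0 : C -> D) := ContraFunctor {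
  fmap_op :> forall X Y : C, hom X Y -> hom (F0 Y) (F0 X);
  fmap_op_id : forall X, fmap_op (idm X) = idm (F0 X);
  fmap_op_comp : forall X Y Z (f : hom Y Z) (g : hom X Y),
    fmap_op (compm f g) = compm (fmap_op g) (fmap_op f)
}.

Section DLat.

Record dlat := DLatPack {
  dlat_disp : Order.disp_t;
  dlat_sort :> tbDistrLatticeType dlat_disp
}.

(* The library's {tblmorphism D -> E} only asks for the bounds to be
   preserved, not for the lattice operations. *)
Record dlat_hom (D E : dlat) := DLatHom {
  dlat_fun :> D -> E;
  dlat_hom0 : dlat_fun \bot%O = \bot%O;
  dlat_hom1 : dlat_fun \top%O = \top%O;
  dlat_homI : {morph dlat_fun : a b / (a `&` b)%O};
  dlat_homU : {morph dlat_fun : a b / (a `|` b)%O}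
}.

Lemma dlat_hom_eq (D E : dlat) (f g : dlat_hom D E) :
  dlat_fun f = dlat_fun g -> f = g.
Proof.
case: f g => [f f0 f1 fI fU] [g g0 g1 gI gU] /= fg; case: _ / fg in g0 g1 gI gU *.
by congr DLatHom; exact: Prop_irrelevance.
Qed.

Definition dlat_id (D : dlat) : dlat_hom D D.
Proof. by exists idfun. Defined.

Definition dlat_comp (D E F : dlat) (f : dlat_hom E F) (g : dlat_hom D E) :
  dlat_hom D F.
Proof.
by exists (f \o g) => [||a b|a b] /=;
  rewrite ?dlat_hom0 ?dlat_hom1 ?dlat_homI ?dlat_homU.
Defined.

Definition DLat : category.
Proof.
by refine (@Category dlat dlat_hom dlat_id dlat_comp _ _ _) => *;
  exact: dlat_hom_eq.
Defined.

End DLat.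

Section Pries.

Definition up_closed d (X : porderType d) (U : set X) : Prop :=
  forall x y, U x -> (x <= y)%O -> U y.

Definition is_priestley d (X : POrderedTopological.type d) : Prop :=
  compact [set: X] /\
  forall x y : X, ~~ (x <= y)%O ->
    exists U : set X, [/\ clopen U, up_closed U, U x & ~ U y].

Record pries := PriesPack {
  pries_disp : Order.disp_t;
  pries_sort :> POrderedTopological.type pries_disp;
  priesP : is_priestley pries_sort
}.

Record pries_hom (X Y : pries) := PriesHom {
  pries_fun :> X -> Y;
  pries_hom_continuous : continuous pries_fun;
  pries_hom_le : {homo pries_fun : x y / (x <= y)%O}
}.

Lemma pries_hom_eq (X Y : pries) (f g : pries_hom X Y) :
  pries_fun f = pries_fun g -> f = g.
Proof.
case: f g => [f cf hf] [g cg hg] /= fg; case: _ / fg in cg hg *.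
by congr PriesHom; exact: Prop_irrelevance.
Qed.

Definition pries_id (X : pries) : pries_hom X X.
Proof. by exists idfun => // x; exact: cvg_id. Defined.

Definition pries_comp (X Y Z : pries) (f : pries_hom Y Z) (g : pries_hom X Y) :
  pries_hom X Z.
Proof.
exists (f \o g) => [x|x y xy /=].
  by apply: continuous_comp; exact: pries_hom_continuous.
by do 2 apply: pries_hom_le.
Defined.

Definition Pries : category.
Proof.
by refine (@Category pries pries_hom pries_id pries_comp _ _ _) => *;
  exact: pries_hom_eq.
Defined.

End Pries.

(* [gminus r] is the symbol r^- and [gcirc q] is the symbol q°. *)
Inductive Gamma (R : realType) :=
| gminus of {r : R | 0 < r <= 1}
| gcirc of {q : rat | 0 <= q <= 1}.
Arguments gcirc {R}.

Section GammaOrder.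
Variable R : realType.
Implicit Types x y z : Gamma R.

Definition gamma_to_sum x : {r : R | 0 < r <= 1} + {q : rat | 0 <= q <= 1} :=
  match x with gminus r => inl r | gcirc q => inr q end.

Definition gamma_of_sum (s : {r : R | 0 < r <= 1} + {q : rat | 0 <= q <= 1}) :
  Gamma R := match s with inl r => gminus r | inr q => gcirc q end.

Lemma gamma_to_sumK : cancel gamma_to_sum gamma_of_sum.
Proof. by case. Qed.

HB.instance Definition _ := Choice.copy (Gamma R) (can_type gamma_to_sumK).

Definition gamma_lt x y : bool :=
  match x, y with
  | gminus r, gminus s => val r < val s
  | gcirc p, gcirc q => val p < val q
  | gminus r, gcirc q => val r <= ratr (val q)
  | gcirc q, gminus r => ratr (val q) < val r
  end.

Lemma gamma_lt_irr : irreflexive gamma_lt.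
Proof. by case=> u /=; rewrite ltxx. Qed.

Lemma gamma_lt_trans : transitive gamma_lt.
Proof.
move=> [y|y] [x|x] [z|z] /= xy yz.
- exact: lt_trans xy yz.
- exact: ltW (lt_le_trans xy yz).
- exact: lt_trans xy yz.
- by rewrite -(ltr_rat R); exact: lt_le_trans xy yz.
- exact: le_lt_trans xy yz.
- by apply: le_trans xy _; rewrite ler_rat ltW.
- by apply: lt_trans yz; rewrite ltr_rat.
- exact: lt_trans xy yz.
Qed.

Fact gamma_display : Order.disp_t. Proof. exact: Order.Disp tt tt. Qed.

HB.instance Definition _ := Order.Lt_isPOrder.Build gamma_display (Gamma R)
  gamma_lt_irr gamma_lt_trans.

Lemma gamma_le_total : total (<=%O : rel (Gamma R)).
Proof.
move=> x y; rewrite !le_eqVlt; case: (eqVneq x y) => [//|xy] /=.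
rewrite /Order.lt /=; case: x y xy => [x|x] [y|y] xy /=.
- by apply: lt_total; apply: contraNneq xy => /val_inj ->.
- by case: leP.
- by case: leP.
- by apply: lt_total; apply: contraNneq xy => /val_inj ->.
Qed.

HB.instance Definition _ := Order.POrder_isTotal.Build gamma_display (Gamma R)
  gamma_le_total.

End GammaOrder.

Definition gamma_subbase (R : realType) : set (set (Gamma R)) :=
  range (fun p => [set x | (gcirc p <= x)%O]) `|`
  [set [set x | (x <= gminus q)%O] | q in [set q | rational (val q)]].

HB.instance Definition _ (R : realType) :=
  @isSubBaseTopological.Build (Gamma R) (set (Gamma R)) (@gamma_subbase R) id.

Section GammaOperations.
Variable R : realType.
Implicit Types x y : Gamma R.

Let circ0_subproof : 0 <= (0 : rat) <= 1. Proof. by []. Qed.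
Let minus1_subproof : 0 < (1 : R) <= 1. Proof. by rewrite ltr01 lexx. Qed.

(* The symbols q° and r^-, with a junk value when q or r is out of range. *)
Definition to_gcirc (q : rat) : Gamma R :=
  gcirc (insubd (exist _ 0 circ0_subproof) q).
Definition to_gminus (r : R) : Gamma R :=
  gminus (insubd (exist _ 1 minus1_subproof) r).

Definition to_gamma (r : R) : Gamma R :=
  if r \in rational then to_gcirc (xget 0 [set q : rat | ratr q = r])
  else to_gminus r.

(* The partial operations x - y and x ~ y, as total functions that are only
   meaningful when y <= x; the value outside this domain is irrelevant. *)
Definition gamma_sub x y : Gamma R :=
  match x, y with
  | gcirc r, gcirc s => to_gcirc (val r - val s)
  | gminus r, gcirc s => to_gminus (val r - ratr (val s))
  | gcirc r, gminus s => to_gamma (ratr (val r) - val s)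
  | gminus r, gminus s => to_gamma (val r - val s)
  end.

(* [supremum x0 A] is the least upper bound of A, or x0 when A is empty; the
   join of the empty family is the bottom element 0°. *)
Definition gamma_sim x y : Gamma R :=
  supremum (to_gcirc 0)
    [set gamma_sub x (gcirc q) | q in [set q | (y < gcirc q <= x)%O]].

End GammaOperations.

Section GammaMeasures.
Variables (R : realType) (D : dlat).

Definition is_gamma_measure (mu : D -> Gamma R) : Prop :=
  [/\ {homo mu : a b / (a <= b)%O},
      mu \bot%O = to_gcirc R 0 /\ mu \top%O = to_gcirc R 1 &
      forall a b : D,
        (gamma_sim (mu a) (mu (a `&` b)) <= gamma_sub (mu (a `|` b)) (mu b))%O
        /\
        (gamma_sub (mu a) (mu (a `&` b)) >= gamma_sim (mu (a `|` b)) (mu b))%O].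

Definition MGamma : Type :=
  set_type [set mu : {ptws D -> Gamma R} | is_gamma_measure mu].

Definition MGamma_fun (mu : MGamma) : D -> Gamma R := set_val mu.
Coercion MGamma_fun : MGamma >-> Funclass.

HB.instance Definition _ := Topological.copy MGamma
  (set_type [set mu : {ptws D -> Gamma R} | is_gamma_measure mu]).

Definition MGamma_le (mu nu : MGamma) : bool :=
  `[< forall a : D, (mu a <= nu a)%O >].

Lemma MGamma_le_refl : reflexive MGamma_le.
Proof. by move=> mu; apply/asboolP => a. Qed.

Lemma MGamma_le_anti : antisymmetric MGamma_le.
Proof.
move=> mu nu /andP[/asboolP mn /asboolP nm]; apply/val_inj/funext => a.
by apply/le_anti/andP; split; [exact: mn | exact: nm].
Qed.

Lemma MGamma_le_trans : transitive MGamma_le.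
Proof.
move=> nu mu la /asboolP mn /asboolP nl; apply/asboolP => a.
exact: le_trans (mn a) (nl a).
Qed.

Fact MGamma_display : Order.disp_t. Proof. exact: Order.Disp tt tt. Qed.

HB.instance Definition _ := Order.Le_isPOrder.Build MGamma_display MGamma
  MGamma_le_refl MGamma_le_anti MGamma_le_trans.

End GammaMeasures.

(* Main.v *)
Require Import Defs.
From HB Require Import structures.
From mathcomp Require Import all_boot all_order all_algebra.
From mathcomp Require Import all_classical all_reals all_analysis.
From mathcomp Require Import lra.

(* An element of Gamma amounts to a cut: the set of rationals p with p° <= x;
   every downward closed set of rationals containing 0 and bounded by 1 arises
   in this way, the order is inclusion and each condition p° <= x is clopen.
   When w <= z, the inequality x ~ y <= z - w says that p + q' lies in the cut
   of z whenever q and p + q lie in that of x, q does not lie in that of y and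
   q' lies in that of w. The axioms of a measure are thus conjunctions of
   conditions each involving finitely many cut memberships, so they survive
   ultrafilter limits, which are computed pointwise by putting p in the cut at a
   when p lies in the cut of mu a for almost all mu. *)

Set Implicit Arguments.
Unset Strict Implicit.
Unset Printing Implicit Defensive.

Import Order.TTheory GRing.Theory Num.Theory.

Local Open Scope classical_set_scope.
Local Open Scope ring_scope.

(** * Elements of [Gamma] as cuts of rationals *)

Section Cut.
Variable R : realType.
Implicit Types (x y z w : Gamma R) (p q : rat).

(** The condition p° <= x, extended to all rationals: it holds for p <= 0 and fails for p > 1, so
    that sums p + q need no range condition. *)
Definition cut x p : bool :=
  match x with gminus r => ratr p < val r | gcirc q => p <= val q end.

Lemma cut_down x p q : q <= p -> cut x p -> cut x q.
Proof.
case: x => u /= qp; last exact: le_trans.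
by apply: le_lt_trans; rewrite ler_rat.
Qed.

Lemma cut_le0 x p : p <= 0 -> cut x p.
Proof.
move=> p0; apply: (cut_down p0); case: x => [[r /= /andP[r0 _]]|[q /= /andP[]//]].
by rewrite rmorph0.
Qed.

Lemma cut_le1 x p : cut x p -> p <= 1.
Proof.
case: x => [[r /= /andP[_ r1]]|[q /= /andP[_ q1]]] xp; last first.
  exact: le_trans xp q1.
by rewrite -(ler_rat R) rmorph1; exact/ltW/(lt_le_trans xp).
Qed.

Lemma gcirc_le (p : {q : rat | 0 <= q <= 1}) x :
  (gcirc p <= x)%O = cut x (val p).
Proof.
rewrite le_eqVlt; case: x => u.
  by rewrite [X in _ || X]/(_ < _).
by rewrite [X in _ || X]/(_ < _) /= le_eqVlt.
Qed.

Lemma cut_itv x p : 0 <= p -> cut x p -> 0 <= p <= 1.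
Proof. by move=> p0 /cut_le1 p1; rewrite p0. Qed.

(** For x = q° it suffices to test p = q. If x = r^- and y < x, a rational strictly between their
    values lies in the cut of x only. *)
Lemma gamma_leP x y : (x <= y)%O <-> forall p, cut x p -> cut y p.
Proof.
split=> [xy p xp|xy].
  have [/cut_le0//|/ltW p0] := leP p 0.
  have : (gcirc (exist _ p (cut_itv p0 xp)) <= x)%O by rewrite gcirc_le.
  by move=> /le_trans/(_ xy); rewrite gcirc_le.
case: x xy => [r|q] xy; last by rewrite gcirc_le; apply: xy => /=.
rewrite leNgt; apply/negP => yr; have {yr} : gamma_lt y (gminus r) := yr.
case: y xy => [s|q] xy /= lt_yx.
  have [p /[!in_itv]/= /andP[sp pr]] := rat_in_itvoo lt_yx.
  by have := xy p pr; rewrite /= ltNge (ltW sp).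
have [p /[!in_itv]/= /andP[sp pr]] := rat_in_itvoo lt_yx.
by have := xy p pr; rewrite /= leNgt -(ltr_rat R) sp.
Qed.

(** The supremum s of S decides: x is s° if s is attained in S, and s^- otherwise. *)
Lemma cut_exists (S : set rat) : S 0 -> (forall p, S p -> p <= 1) ->
  (forall p q, q <= p -> S p -> S q) -> exists x, forall p, cut x p <-> S p.
Proof.
move=> S0 S1 Sdown; set A := [set (ratr p : R) | p in S].
have A0 : A 0 by exists 0; rewrite ?rmorph0.
have A1 : ubound A 1 by move=> _ [p /S1 p1 <-]; rewrite -(rmorph1 ratr) ler_rat.
have supA : has_sup A by split; [exists 0 | exists 1].
have ubA p : S p -> ratr p <= sup A.
  by move=> Sp; apply: ub_le_sup supA.2 _ _; exists p.
have sup0 : 0 <= sup A by rewrite -(rmorph0 ratr); exact: ubA.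
have sup1 : sup A <= 1 by apply: ge_sup => //; exists 0.
have [[q Sq qE]|noq] := pselect (exists2 q, S q & ratr q = sup A).
  have q01 : 0 <= q <= 1.
    by rewrite S1// andbT -(ler_rat R) rmorph0 qE.
  exists (gcirc (exist _ q q01)) => p /=; split=> [pq|/ubA]; first exact: Sdown Sq.
  by rewrite -qE ler_rat.
(* A supremum equal to 0 would be attained, since 0 is in S. *)
have sup_gt0 : 0 < sup A <= 1.
  rewrite sup1 andbT lt_neqAle sup0 andbT; apply/eqP => s0.
  by apply: noq; exists 0; rewrite ?rmorph0.
exists (gminus (exist _ (sup A) sup_gt0)) => p /=; split=> [pA|Sp].
  have [|_ [q Sq <-]] := @sup_adherent _ A (sup A - ratr p) _ supA.
    by rewrite subr_gt0.
  by rewrite subKr ltr_rat => /ltW pq; exact: Sdown Sq.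
by rewrite lt_neqAle ubA// andbT; apply/eqP => pA; apply: noq; exists p.
Qed.

(** The union of the cuts of the members of A is again a cut. *)
Lemma gamma_sup (A : set (Gamma R)) : A !=set0 -> supremums A !=set0.
Proof.
move=> [x Ax].
have [||p q qp [y Ay yp]|s sE] :=
    @cut_exists [set p | exists2 x, A x & cut x p].
- by exists x => //; exact: cut_le0.
- by move=> p [y _ /cut_le1].
- by exists y => //; exact: cut_down yp.
exists s; split=> [y Ay|y ubAy]; apply/gamma_leP => p.
  by move=> yp; apply/sE; exists y.
by move/sE => [z Az zp]; have /gamma_leP := ubAy z Az; apply.
Qed.

Lemma cut_to_gcirc q p : 0 <= q <= 1 -> cut (to_gcirc R q) p = (p <= q).
Proof. by move=> q01; rewrite /to_gcirc /cut val_insubd q01. Qed.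

Lemma cut_to_gminus (r : R) p : 0 < r <= 1 -> cut (to_gminus r) p = (ratr p < r).
Proof. by move=> r01; rewrite /to_gminus /cut val_insubd r01. Qed.

(** The two branches of [to_gamma] merge: no rational equals an irrational r, so strict and weak
    inequality agree there. *)
Lemma cut_to_gamma (r : R) p :
  0 <= r <= 1 -> cut (to_gamma r) p = (ratr p <= r).
Proof.
move=> /andP[r0 r1]; rewrite /to_gamma; case: ifPn => [/set_mem [q _ qr]|/negP rQ].
  case: xgetP => [q' _ q'r|/(_ q)]; last by move=> /(_ qr).
  rewrite cut_to_gcirc; last first.
    by rewrite -!(ler_rat R) q'r rmorph0 rmorph1 r0.
  by rewrite -(ler_rat R) q'r.
have rN q : ratr q != r.
  by apply/eqP => qr; apply: rQ; apply/mem_set; exists q.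
rewrite cut_to_gminus; last by rewrite r1 andbT lt_neqAle r0 -(rmorph0 ratr) rN.
by rewrite le_eqVlt (negbTE (rN p)).
Qed.

(** Subtraction is the residual of addition of cuts. For y = s° it suffices to test q = s. For y =
    s^- the bound s is not attained by the q, and density yields a weak inequality, which is the cut
    of [to_gamma]. *)
Lemma cut_sub x y p : (y <= x)%O ->
  cut (gamma_sub x y) p <-> forall q, cut y q -> cut x (p + q).
Proof.
have le_dense (s t : R) : (forall q : rat, ratr q < s -> ratr q <= t) -> s <= t.
  move=> st; rewrite leNgt; apply/negP => /rat_in_itvoo[q].
  by rewrite in_itv /= => /andP[tq /st]; rewrite leNgt tq.
rewrite le_eqVlt => yx; have {yx} : (y == x) || gamma_lt y x := yx.
case: x => -[r r01]; case: y => -[s s01] yx; rewrite /= in yx.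
- have {}yx : s <= r by case/orP: yx => [/eqP[->]|/ltW].
  have /andP[r0 r1] : 0 < r <= 1 := r01.
  have /andP[s0 s1] : 0 < s <= 1 := s01.
  rewrite [gamma_sub _ _]/(to_gamma (r - s)) cut_to_gamma; last by lra.
  split=> /= [prs q qs|rs]; first by rewrite rmorphD/=; lra.
  suff : s <= r - ratr p by lra.
  by apply: le_dense => q /rs; rewrite rmorphD/=; lra.
- have /andP[r0 r1] : 0 < r <= 1 := r01.
  have /andP[s0 s1] : 0 <= s <= 1 := s01.
  have Rs0 : 0 <= ratr s :> R by rewrite ler0q.
  rewrite [gamma_sub _ _]/(to_gminus (r - ratr s)) cut_to_gminus; last by lra.
  split=> /= [prs q qs|/(_ s (lexx s))]; last by rewrite rmorphD/=; lra.
  have : ratr q <= ratr s :> R by rewrite ler_rat.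
  by rewrite rmorphD/=; lra.
- have /andP[r0 r1] : 0 <= r <= 1 := r01.
  have /andP[s0 s1] : 0 < s <= 1 := s01.
  have Rr1 : ratr r <= 1 :> R by rewrite -(rmorph1 ratr) ler_rat.
  rewrite [gamma_sub _ _]/(to_gamma (ratr r - s)) cut_to_gamma; last by lra.
  split=> /= [prs q qs|rs]; first by rewrite -(ler_rat R) rmorphD/=; lra.
  suff : s <= ratr r - ratr p by lra.
  by apply: le_dense => q /rs; rewrite -(ler_rat R) rmorphD/=; lra.
- have {}yx : s <= r by case/orP: yx => [/eqP[->]|/ltW].
  have /andP[r0 r1] : 0 <= r <= 1 := r01.
  have /andP[s0 s1] : 0 <= s <= 1 := s01.
  rewrite [gamma_sub _ _]/(to_gcirc R (r - s)) cut_to_gcirc; last by lra.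
  by split=> /= [prs q qs|/(_ s (lexx s))]; lra.
Qed.

Lemma cut_sub_gcirc x (q : {q : rat | 0 <= q <= 1}) p : (gcirc q <= x)%O ->
  cut (gamma_sub x (gcirc q)) p = cut x (p + val q).
Proof.
move=> qx; apply/idP/idP; first by move/(cut_sub _ qx); apply => /=.
move=> xpq; apply/(cut_sub _ qx) => q' /= q'q.
by apply: cut_down xpq; rewrite lerD2l.
Qed.

Lemma sim_leP x y z : (gamma_sim x y <= z)%O <->
  forall q : {q : rat | 0 <= q <= 1},
    (y < gcirc q <= x)%O -> (gamma_sub x (gcirc q) <= z)%O.
Proof.
rewrite /gamma_sim /supremum.
set A := (X in X == set0); case: ifPn => [/eqP A0|/set0P A0].
  (* The supremum of an empty family is the default 0°, which lies below every z. *)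
  split=> _; last by rewrite /to_gcirc gcirc_le val_insubd; exact: cut_le0.
  move=> q yqx; have : A (gamma_sub x (gcirc q)) by exists q.
  by rewrite A0.
case: xgetP => [s _ [ubs lbs]|none]; last first.
  by have [s /none] := gamma_sup A0.
split=> [sz q yqx|le_z]; first by apply: le_trans sz; apply: ubs; exists q.
by apply: lbs => _ [q yqx <-]; exact: le_z.
Qed.

(** The range condition on q is implicit: q lies outside the cut of y, so 0 <= q, and inside that of
    x, so q <= 1. *)
Lemma sim_le_subP x y z w : (w <= z)%O ->
  (gamma_sim x y <= gamma_sub z w)%O <->
  forall p q q', [&& ~~ cut y q, cut x q, cut x (p + q) & cut w q'] ->
    cut z (p + q').
Proof.
move=> wz; rewrite sim_leP; split=> [le_sub p q q' /and4P[yq xq xpq wq']|zw q].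
  have q0 : 0 <= q by rewrite leNgt; apply: contra yq => /ltW; exact: cut_le0.
  have qx : (gcirc (exist _ q (cut_itv q0 xq)) <= x)%O by rewrite gcirc_le.
  have /le_sub/gamma_leP/(_ p) : (y < gcirc (exist _ q (cut_itv q0 xq)) <= x)%O.
    by rewrite qx ltNge gcirc_le yq.
  by rewrite cut_sub_gcirc// => /(_ xpq)/(cut_sub _ wz); apply.
rewrite ltNge !gcirc_le => /andP[yq xq]; apply/gamma_leP => p.
rewrite cut_sub_gcirc ?gcirc_le// => xpq; apply/(cut_sub _ wz) => q' wq'.
by apply: (zw _ (val q)); rewrite yq xq xpq.
Qed.

End Cut.

(** Every neighbourhood of s contains the preimage of an open set around f s. *)
Lemma cvg_initial (S : choiceType) (T : topologicalType) (f : S -> T)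
    (F : set_system S) (s : S) : Filter F ->
  f @ F --> f s -> F --> (s : initial_topology f).
Proof.
move=> FF Ff A /= [_ [[B Bop <-] Bfs sBfA]].
by apply: filterS sBfA _; apply: Ff; exact: open_nbhs_nbhs.
Qed.

(** * The topology of [Gamma] through cuts *)

Section GammaTopology.
Variable R : realType.
Implicit Types (x y : Gamma R) (p q : rat).

Lemma ge_gcirc_set (p : {q : rat | 0 <= q <= 1}) :
  [set x | (gcirc p <= x)%O] = [set x : Gamma R | cut x (val p)].
Proof. by apply/seteqP; split=> x /=; rewrite gcirc_le. Qed.

(* [r^-] is the immediate predecessor of [r°] when [r] is rational. *)
Lemma le_gminus_set (r : {r : R | 0 < r <= 1}) p : ratr p = val r ->
  [set x | (x <= gminus r)%O] = [set x : Gamma R | ~~ cut x p].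
Proof.
move=> pr; suff gtE x : (gminus r < x)%O = cut x p.
  by apply/seteqP; split=> x /=; rewrite leNgt gtE.
rewrite [LHS]/(gamma_lt (gminus r) x).
by case: x => s; rewrite /gamma_lt -pr// ler_rat.
Qed.

Lemma gamma_subbase_cut (A : set (Gamma R)) : gamma_subbase A ->
  exists p b, A = [set x | cut x p = b].
Proof.
case=> [[p _ <-]|[r [p _ pr] <-]].
  by exists (val p), true; exact: ge_gcirc_set.
exists p, false; rewrite (le_gminus_set pr).
by apply/seteqP; split=> x /= => [/negbTE|->].
Qed.

Lemma open_gamma_subbase (A : set (Gamma R)) : gamma_subbase A -> open A.
Proof.
by move=> sA; exists [set A]; [move=> _ ->; exact: finI_from1|rewrite bigcup_set1].
Qed.

Lemma open_cut p : open [set x : Gamma R | cut x p].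
Proof.
(* For p <= 0 or p > 1 the set is everything or empty; in between it is subbasic. *)
have [p0|/ltW p0] := leP p 0.
  rewrite (_ : [set _ | _] = setT); first exact: openT.
  by apply/seteqP; split=> // x _; exact: cut_le0.
have [p1|p1] := leP p 1; last first.
  rewrite (_ : [set _ | _] = set0); first exact: open0.
  by apply/seteqP; split=> // x /cut_le1; rewrite leNgt p1.
have p01 : 0 <= p <= 1 by rewrite p0.
rewrite -(ge_gcirc_set (exist _ p p01)).
by apply: open_gamma_subbase; left; exists (exist _ p p01).
Qed.

Lemma open_cutC p : open [set x : Gamma R | ~~ cut x p].
Proof.
have [p0|p0] := leP p 0.
  rewrite (_ : [set _ | _] = set0); first exact: open0.
  by apply/seteqP; split=> // x /=; rewrite cut_le0.
have [p1|p1] := leP p 1; last first.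
  rewrite (_ : [set _ | _] = setT); first exact: openT.
  by apply/seteqP; split=> // x _; apply/negP => /cut_le1; rewrite leNgt p1.
have p01 : 0 < (ratr p : R) <= 1.
  by rewrite ltr0q p0 -(rmorph1 ratr) ler_rat.
rewrite -(@le_gminus_set (exist _ (ratr p) p01))//.
by apply: open_gamma_subbase; right; exists (exist _ (ratr p) p01) => //; exists p.
Qed.

Lemma clopen_cut p : clopen [set x : Gamma R | cut x p].
Proof.
split; first exact: open_cut.
rewrite -[X in closed X]setCK; apply: open_closedC.
rewrite (_ : ~` _ = [set x | ~~ cut x p]); first exact: open_cutC.
by apply/seteqP; split=> x /= /negP.
Qed.

Lemma near_cut x p : \forall y \near x, cut y p = cut x p.
Proof.
have [xp|xp] := boolP (cut x p).
  by apply: open_nbhs_nbhs; split; [exact: open_cut|].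
have : nbhs x [set y | ~~ cut y p].
  by apply: open_nbhs_nbhs; split; [exact: open_cutC|].
by apply: filterS => y /negbTE.
Qed.

(** Basic open sets are finite intersections of subbasic ones, each of which fixes the truth value
    of one cut membership. *)
Lemma cvg_gamma (F : set_system (Gamma R)) x : Filter F ->
  (forall p, F [set y | cut y p = cut x p]) -> F --> x.
Proof.
move=> FF Fx A; rewrite nbhsE => -[B [[D subD <-]] [C DC Cx] sBA].
have [E subE CE] := subD _ DC.
suff FC : F C by apply: filterS FC => y Cy; apply: sBA; exists C.
rewrite -CE in Cx *; apply: filter_bigI => G EG.
have /set_mem/gamma_subbase_cut[p [b GE]] := subE _ EG.
have := Cx _ EG; rewrite GE => /= xb.
by apply: filterS (Fx p) => y /= ->.
Qed.

End GammaTopology.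

(** * The Priestley space of measures *)

Section MGammaTopology.
Variables (R : realType) (D : dlat).
Implicit Types mu nu : MGamma R D.

Lemma MGamma_eval_continuous (a : D) :
  continuous (fun mu : MGamma R D => (mu : D -> Gamma R) a).
Proof.
move=> mu; apply: (@continuous_comp _ _ _
  (fun mu : MGamma R D => set_val mu : {ptws D -> Gamma R})
  (fun f : {ptws D -> Gamma R} => f a)).
  exact: initial_continuous.
exact: (@proj_continuous D (fun=> Gamma R) a).
Qed.

(** [cvg_initial] applies twice: to the inclusion into the product, then to each evaluation. *)
Lemma MGamma_cvg (F : set_system (MGamma R D)) nu : Filter F ->
  (forall a p, F [set mu : MGamma R D | cut (mu a) p = cut (nu a) p]) ->
  F --> nu.
Proof.
move=> FF Fnu; apply: cvg_initial; apply/cvg_sup => a.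
by apply: cvg_initial; apply: cvg_gamma => p; exact: Fnu.
Qed.

Lemma MGamma_compact : compact [set: MGamma R D].
Proof.
rewrite compact_ultra => F FU _.
have FC (A : set (MGamma R D)) : ~ F A -> F (~` A).
  by case: (in_ultra_setVsetC A FU).
(* The conditions of [cut_exists] are inherited from the cuts of the mu a; the bound by 1 uses that
   sets in F are nonempty. *)
have limit_cut a : exists x : Gamma R, forall p,
    cut x p <-> F [set mu : MGamma R D | cut (mu a) p].
  apply: cut_exists.
  - by apply: filterE => mu; exact: cut_le0.
  - by move=> p /filter_ex[mu]; exact: cut_le1.
  - by move=> p q qp; apply: filterS => mu; exact: cut_down.
have {limit_cut}[nu nuE] := choice limit_cut.
(* The ultrafilter property enters here: a p outside the limit cut is omitted by almost all mu. *)
have nuF a p : F [set mu : MGamma R D | cut (mu a) p = cut (nu a) p].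
  have [/nuE|/negP nuap] := boolP (cut (nu a) p).
    by apply: filterS => mu /= ->.
  have /FC : ~ F [set mu : MGamma R D | cut (mu a) p] by move/nuE.
  by apply: filterS => mu /negP/negbTE.
have nu_homo : {homo nu : a b / (a <= b)%O}.
  move=> a b ab; apply/gamma_leP => p /nuE nuap; apply/nuE.
  apply: filterS nuap => mu; have [mu_homo _ _] := set_valP mu.
  by have /gamma_leP := mu_homo _ _ ab; apply.
have nu_sim a b c d : (d <= c)%O -> (forall mu : MGamma R D,
      (gamma_sim (mu a) (mu b) <= gamma_sub (mu c) (mu d))%O) ->
    (gamma_sim (nu a) (nu b) <= gamma_sub (nu c) (nu d))%O.
  move=> dc le_mu; apply/sim_le_subP; first exact: nu_homo.
  (* For fixed p, q and q', a single mu shares all five memberships with nu, so its own inequality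
     decides. *)
  move=> p q q'; near F => mu.
  have <- : cut (MGamma_fun mu b) q = cut (nu b) q by near: mu; exact: nuF.
  have <- : cut (MGamma_fun mu a) q = cut (nu a) q by near: mu; exact: nuF.
  have <- : cut (MGamma_fun mu a) (p + q) = cut (nu a) (p + q).
    by near: mu; exact: nuF.
  have <- : cut (MGamma_fun mu d) q' = cut (nu d) q' by near: mu; exact: nuF.
  have <- : cut (MGamma_fun mu c) (p + q') = cut (nu c) (p + q').
    by near: mu; exact: nuF.
  have [mu_homo _ _] := set_valP mu.
  by have /sim_le_subP := le_mu mu; apply; exact: mu_homo.
have nu_const a x : (forall mu : MGamma R D, mu a = x) -> nu a = x.
  move=> mu_x; apply/le_anti/andP; split; apply/gamma_leP => p.
    by case/nuE/filter_ex => mu /=; rewrite mu_x.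
  by move=> xp; apply/nuE; apply: filterE => mu /=; rewrite mu_x.
have nuP : is_gamma_measure nu.
  split=> //.
    by split; apply: nu_const => mu; have [_ [mu0 mu1] _] := set_valP mu.
  (* With m and j the meet and join of a and b, the quadruple is (a, m, j, b) for the first
     inequality and (j, b, a, m) for the second. *)
  move=> a b; split; apply: nu_sim => [|mu].
  - exact: leUr.
  - by have [_ _ /(_ a b)[]] := set_valP mu.
  - exact: leIl.
  - by have [_ _ /(_ a b)[]] := set_valP mu.
exists (exist _ nu (mem_set nuP)); split=> //.
exact: MGamma_cvg.
Unshelve. all: by end_near.
Qed.

(** A failure of mu <= nu is witnessed by one a and one p, and membership of p in the cut at a
    defines a separating clopen upset. *)
Lemma MGamma_priestley : is_priestley (MGamma R D).
Proof.
split=> [|mu nu /asboolPn/existsNP[a /gamma_leP/existsNP[p /not_implyP[mup nup]]]].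
  exact: MGamma_compact.
exists [set la : MGamma R D | cut (la a) p]; split=> //.
  have [oC cC] := clopen_cut R p.
  by split; [apply: open_comp oC|apply: preimage_closed cC] => la _;
    exact: MGamma_eval_continuous.
by move=> la rho lap /asboolP/(_ a)/gamma_leP; apply.
Qed.

End MGammaTopology.

(** * Precomposition with a lattice homomorphism *)

Section Pullback.
Variables (R : realType) (D E : dlat) (h : dlat_hom D E).

Lemma is_gamma_measure_comp (mu : E -> Gamma R) :
  is_gamma_measure mu -> is_gamma_measure (mu \o h).
Proof.
case=> mu_homo [mu0 mu1] muUI; split=> [a b ab /=||a b /=].
(* Preservation of meets makes h monotone. *)
- by apply: mu_homo; apply/meet_idPl; rewrite -dlat_homI (meet_idPl ab).
- by rewrite /= dlat_hom0 dlat_hom1.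
- by rewrite dlat_homI dlat_homU; exact: muUI.
Qed.

Definition MGamma_pullback (mu : MGamma R E) : MGamma R D :=
  exist _ (MGamma_fun mu \o h)
    (mem_set (is_gamma_measure_comp (set_valP mu))).

(** Membership of p in the cut of the pullback at a is membership in the cut of mu at h a, which is
    locally constant in mu. *)
Lemma MGamma_pullback_continuous : continuous MGamma_pullback.
Proof.
move=> mu; apply: MGamma_cvg => [|a p].
  exact: (@fmap_filter _ _ MGamma_pullback _ (@nbhs_filter (MGamma R E) mu)).
exact: MGamma_eval_continuous (near_cut _ p).
Qed.

Lemma MGamma_pullback_homo : {homo MGamma_pullback : mu nu / (mu <= nu)%O}.
Proof. by move=> mu nu /asboolP mn; apply/asboolP => a; exact: mn. Qed.

End Pullback.

Lemma MGamma_inj (R : realType) (D : dlat) : injective (@MGamma_fun R D).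
Proof. by move=> mu nu; exact: val_inj. Qed.

Theorem lemma4p4 (R : realType) :
  exists (MP : forall D : dlat, is_priestley (MGamma R D))
         (F : contrafunctor (C := DLat) (D := Pries)
                (fun D : dlat => PriesPack (MP D))),
    forall (D E : dlat) (h : dlat_hom D E) (mu : MGamma R E),
      MGamma_fun (pries_fun (F D E h) mu) = MGamma_fun mu \o h.
Proof.
exists (@MGamma_priestley R).
unshelve eexists.
  unshelve eapply (@ContraFunctor DLat Pries
    (fun D => PriesPack (MGamma_priestley R D)) (fun D E h =>
      @PriesHom (PriesPack (MGamma_priestley R E))
        (PriesPack (MGamma_priestley R D)) (MGamma_pullback h)
        (@MGamma_pullback_continuous R D E h) (@MGamma_pullback_homo R D E h))).
  (* Both functor laws hold by computation on the underlying functions, which determine measures and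
     morphisms. *)
  - by move=> D; apply: pries_hom_eq; apply/funext => mu; exact: MGamma_inj.
  - by move=> D E F g h; apply: pries_hom_eq; apply/funext => mu; exact: MGamma_inj.
by [].
Qed.
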